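(* Suppose that $m$ resources all have unit delay ($d_1=\dots=d_m=1$). Then an optimal (lowest-cost) assignment of $n$ tasks with arbitrary weights $w_1,\dots,w_n$ to those resources may be found in time $O(n^2m)$.
   Context: A problem instance $(T,R)$ consists of a set $R=\{1,\dots,m\}$ of resources with delays (positive reals) $d_1\le\dots\le d_m$ and a set $T=\{1,\dots,n\}$ of tasks with real weights $w_1,\dots,w_n\ge 1$. An assignment is a vector $A=(A_1,\dots,A_n)\in\{1,\dots,m\}^n$ (task $i$ is assigned to resource $A_i$). The load of resource $\ell$ in $A$ is $L(\ell,A)=d_\ell\sum_{i\in T:\,A_i=\ell}w_i$, and the social cost is $C(A)=\sum_{i\in T}L(A_i,A)$. An optimal assignment is one minimizing $C$ over all assignments. Running time counts elementary arithmetic operations and comparisons. *)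

(* Defs.v *)
From mathcomp Require Import all_boot all_order all_algebra.
From mathcomp Require Import reals.

Set Implicit Arguments.
Unset Strict Implicit.
Unset Printing Implicit Defensive.

Import Order.TTheory GRing.Theory Num.Theory.
Local Open Scope ring_scope.

(* Resources and tasks are numbered from 0. *)
Record instance (R : realType) (m n : nat) := Instance {
  delay : 'I_m -> R;
  weight : 'I_n -> R;
  delay_gt0 : forall l, 0 < delay l;
  delay_mono : forall k l : 'I_m, (k <= l)%N -> delay k <= delay l;
  weight_ge1 : forall i, 1 <= weight i
}.

Definition assignment (m n : nat) := {ffun 'I_n -> 'I_m}.

Section Cost.
Variables (R : realType) (m n : nat) (I : instance R m n).

Definition load (l : 'I_m) (A : assignment m n) : R :=
  delay I l * \sum_(i < n | A i == l) weight I i.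

Definition social_cost (A : assignment m n) : R := \sum_(i < n) load (A i) A.

Definition optimal (A : assignment m n) : Prop :=
  forall B : assignment m n, social_cost A <= social_cost B.

Definition unit_delay : Prop := forall l, delay I l = 1.

End Cost.

(* Running time is measured on a real RAM, presented as a structured language.
   The memory is made of numbered arrays of natural numbers (for indices) and
   numbered arrays of reals; array names are fixed in the program text, array
   indices are computed.  A program is a finite syntactic object that mentions
   neither the instance nor its size.  There is no rounding of reals, no
   conversion between the two sorts and no multiplication of indices. *)
Inductive iexp : Type :=
| ICst of nat
| IGet of nat & iexp
| IAdd of iexp & iexp
| ISub of iexp & iexp.

Inductive rexp : Type :=
| RZero
| ROne
| RGet of nat & iexp
| RAdd of rexp & rexp
| RSub of rexp & rexp
| RMul of rexp & rexp
| RDiv of rexp & rexp.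

Inductive bexp : Type :=
| BILe of iexp & iexp
| BRLe of rexp & rexp
| BNot of bexp
| BAnd of bexp & bexp.

(* [CISet a e f] is the assignment a[e] := f to an array of naturals, [CRSet]
   the same for an array of reals. *)
Inductive cmd : Type :=
| CSkip
| CISet of nat & iexp & iexp
| CRSet of nat & iexp & rexp
| CSeq of cmd & cmd
| CIf of bexp & cmd & cmd
| CWhile of bexp & cmd.

Local Open Scope nat_scope.

(* Every constant, memory access, operation and comparison costs one step. *)
Fixpoint icost (e : iexp) : nat :=
  match e with
  | ICst _ => 1
  | IGet _ e1 => (icost e1).+1
  | IAdd e1 e2 | ISub e1 e2 => (icost e1 + icost e2).+1
  end.

Fixpoint rcost (e : rexp) : nat :=
  match e with
  | RZero | ROne => 1
  | RGet _ e1 => (icost e1).+1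
  | RAdd e1 e2 | RSub e1 e2 | RMul e1 e2 | RDiv e1 e2 =>
      (rcost e1 + rcost e2).+1
  end.

Fixpoint bcost (b : bexp) : nat :=
  match b with
  | BILe e1 e2 => (icost e1 + icost e2).+1
  | BRLe e1 e2 => (rcost e1 + rcost e2).+1
  | BNot b1 => (bcost b1).+1
  | BAnd b1 b2 => (bcost b1 + bcost b2).+1
  end.

Local Close Scope nat_scope.

Record state (R : realType) := State {
  ints : nat -> nat -> nat;
  reals : nat -> nat -> R
}.

Definition upd (V : Type) (mem : nat -> nat -> V) (a j : nat) (v : V) :
    nat -> nat -> V :=
  fun b k => if (b == a) && (k == j) then v else mem b k.

Section Semantics.
Variable R : realType.
Implicit Type s : state R.

(* [ISub] is truncated at 0. *)
Fixpoint ieval s (e : iexp) : nat :=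
  match e with
  | ICst k => k
  | IGet a e1 => ints s a (ieval s e1)
  | IAdd e1 e2 => (ieval s e1 + ieval s e2)%N
  | ISub e1 e2 => (ieval s e1 - ieval s e2)%N
  end.

(* Division by zero yields 0. *)
Fixpoint reval s (e : rexp) : R :=
  match e with
  | RZero => 0
  | ROne => 1
  | RGet a e1 => reals s a (ieval s e1)
  | RAdd e1 e2 => reval s e1 + reval s e2
  | RSub e1 e2 => reval s e1 - reval s e2
  | RMul e1 e2 => reval s e1 * reval s e2
  | RDiv e1 e2 => reval s e1 / reval s e2
  end.

Fixpoint beval s (b : bexp) : bool :=
  match b with
  | BILe e1 e2 => (ieval s e1 <= ieval s e2)%N
  | BRLe e1 e2 => reval s e1 <= reval s e2
  | BNot b1 => ~~ beval s b1
  | BAnd b1 b2 => beval s b1 && beval s b2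
  end.

(* [exec c s t s']: started in s, c terminates in s' after t steps. *)
Inductive exec : cmd -> state R -> nat -> state R -> Prop :=
| exec_skip s : exec CSkip s 0%N s
| exec_iset s a e f :
    exec (CISet a e f) s (icost e + icost f).+1%N
      (State (upd (ints s) a (ieval s e) (ieval s f)) (reals s))
| exec_rset s a e f :
    exec (CRSet a e f) s (icost e + rcost f).+1%N
      (State (ints s) (upd (reals s) a (ieval s e) (reval s f)))
| exec_seq c1 c2 s1 s2 s3 t1 t2 :
    exec c1 s1 t1 s2 -> exec c2 s2 t2 s3 ->
    exec (CSeq c1 c2) s1 (t1 + t2)%N s3
| exec_if b c1 c2 s s' t :
    exec (if beval s b then c1 else c2) s t s' ->
    exec (CIf b c1 c2) s (bcost b + t)%N s'
| exec_while_false b c s :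
    ~~ beval s b -> exec (CWhile b c) s (bcost b) s
| exec_while_true b c s1 s2 s3 t1 t2 :
    beval s1 b -> exec c s1 t1 s2 -> exec (CWhile b c) s2 t2 s3 ->
    exec (CWhile b c) s1 (bcost b + t1 + t2)%N s3.

(* Natural array 0 holds n and m, real array 0 the weights and real array 1 the
   delays; every other cell is 0. *)
Definition input (m n : nat) (I : instance R m n) : state R :=
  State
    (fun a j => match a, j with 0, 0 => n | 0, 1 => m | _, _ => 0 end)%N
    (fun a j => match a with
                | 0%N => oapp (weight I) 0 (insub j)
                | 1%N => oapp (delay I) 0 (insub j)
                | _ => 0
                end).

(* The answer is read off natural array 1. *)
Definition outputs (m n : nat) s (A : assignment m n) : Prop :=
  forall i : 'I_n, ints s 1%N i = A i.

End Semantics.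

(* Main.v *)
Require Import Defs.
From mathcomp Require Import all_boot all_order all_algebra.
From mathcomp Require Import zify lra.
From mathcomp Require Import reals.

Set Implicit Arguments.
Unset Strict Implicit.
Unset Printing Implicit Defensive.

Import Order.TTheory GRing.Theory Num.Theory.

(** With unit delays the social cost is the sum, over the tasks, of the weight
of the task times the size of its group.  For fixed group sizes the
rearrangement inequality gives the heaviest tasks to the smallest groups, so
some optimal assignment cuts the list of tasks, sorted by decreasing weight,
into [m] (possibly empty) intervals.  Write [S i] for the sum of the [i] largest
weights.  The best way to cut the first [i] tasks into [j + 1] intervals is given by
[F 0 i = i * S i] and
[F (j + 1) i = min_(k <= i) (F j k + (i - k) * (S i - S k))].  The program ranks
the tasks by pairwise comparisons in time [O(n^2)], fills the table of [F] in
time [O(n^2 m)] and recovers the cut points backwards in time [O(n m)]. *)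

(** * Ranking the tasks by decreasing weight *)

Section Rank.
Local Open Scope ring_scope.
Variables (R : realType) (w : nat -> R) (n : nat).

(** Ties in weight are broken by the index, which makes this a strict total order. Reals are
    compared by [<=] only, the one real comparison that the program has. *)
Definition before (k i : nat) : bool :=
  ~~ (w k <= w i) || ((w i <= w k) && (k < i)%N).

Definition rank (i : nat) : nat := (\sum_(k < n) before k i)%N.

Lemma before_irr i : before i i = false.
Proof. by rewrite /before lexx ltnn. Qed.

Lemma before_trans j i k : before i j -> before j k -> before i k.
Proof.
rewrite /before -!ltNge => /orP[h1|/andP[h1 h1']] /orP[h2|/andP[h2 h2']].
- by rewrite (lt_trans h2 h1).
- by rewrite (le_lt_trans h2 h1).
- by rewrite (lt_le_trans h2 h1).
- by rewrite (le_trans h2 h1) (ltn_trans h1' h2') orbT.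
Qed.

Lemma before_total i j : i != j -> before i j || before j i.
Proof.
rewrite /before -!ltNge; case: (ltgtP (w i) (w j)) => //= _.
by rewrite neq_ltn.
Qed.

(** By transitivity every predecessor of [i] precedes [j], and [i] itself is counted for [j]
    alone. *)
Lemma rank_ltn i j : (i < n)%N -> before i j -> (rank i < rank j)%N.
Proof.
move=> ltin bij; rewrite /rank (bigD1 (Ordinal ltin)) //= before_irr add0n.
rewrite [ltnRHS](bigD1 (Ordinal ltin)) //= bij add1n ltnS.
apply: leq_sum => k _; case bki: (before k i) => //.
by rewrite (before_trans bki bij).
Qed.

Lemma rank_inj i j : (i < n)%N -> (j < n)%N -> rank i = rank j -> i = j.
Proof.
move=> ltin ltjn eqr; apply/eqP; case: eqVneq => // /before_total.
by case/orP=> /rank_ltn; rewrite eqr ltnn => ->.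
Qed.

Lemma rank_bound i : (i < n)%N -> (rank i < n)%N.
Proof.
move=> ltin; rewrite /rank (bigD1 (Ordinal ltin)) //= before_irr add0n.
rewrite -[ltnRHS]card_ord -sum1_card [ltnRHS](bigD1 (Ordinal ltin)) //= add1n ltnS.
by apply: leq_sum => k _; case: before.
Qed.

Definition rank_ord (i : 'I_n) : 'I_n := Ordinal (rank_bound (ltn_ord i)).

Lemma rank_ord_inj : injective rank_ord.
Proof.
by move=> i j /(congr1 val) /= /rank_inj e; apply/val_inj/e; apply: ltn_ord.
Qed.

(** The default 0 past the last rank keeps the sequence nonincreasing on all of [nat] when the
    weights are nonnegative. *)
Definition by_rank (x : nat) : R :=
  oapp (fun i : 'I_n => w i) 0 [pick i : 'I_n | rank i == x].

Lemma by_rankK i : (i < n)%N -> by_rank (rank i) = w i.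
Proof.
move=> ltin; rewrite /by_rank; case: pickP => [j /eqP e|/(_ (Ordinal ltin))] /=.
  by rewrite (rank_inj _ _ e).
by rewrite eqxx.
Qed.

Lemma by_rank_anti :
  (forall i, 0 <= w i) -> {homo by_rank : x y / (x <= y)%N >-> y <= x}.
Proof.
move=> w_ge0 x y; rewrite /by_rank.
case: (pickP (fun i : 'I_n => rank i == y)) => [i /eqP <- | _ _] /=; last first.
  by case: pickP => /=.
case: pickP => [j /eqP <- | none] /= lexy.
  rewrite leNgt; apply/negP => ltw.
  have: before i j by rewrite /before -ltNge ltw.
  by move=> /(rank_ltn (ltn_ord i)); rewrite ltnNge lexy.
(* Being at most a rank, [x] is below [n]; an injective map of ['I_n] to itself is onto, so some
   task has rank [x]. *)
have ltxn : (x < n)%N by apply: leq_ltn_trans lexy (rank_bound _).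
have [g _ gK] := injF_bij rank_ord_inj.
by have := none (g (Ordinal ltxn)); rewrite -[rank _]/(val (rank_ord _)) gK /= eqxx.
Qed.

End Rank.

(** * The dynamic program *)

Section Dynamic.
Local Open Scope ring_scope.
Variables (R : realType) (v : nat -> R).

Definition psum (i : nat) : R := \sum_(x < i) v x.

Definition block_cost (k i : nat) : R := (i%:R - k%:R) * (psum i - psum k).

(** A running minimum with a cut point attaining it, visiting the candidates in the order of
    [best_cut]. The starting value is the cut at [i], that is, an empty last group. *)
Fixpoint scan (f : nat -> R) (i k : nat) : R * nat :=
  if k is k'.+1 then
    let p := scan f i k' in
    let c := f k' + block_cost k' i in
    if c <= p.1 then (c, k') else p
  else (f i, i).

Fixpoint opt_cost (j i : nat) : R :=
  if j is j'.+1 then (scan (opt_cost j') i i).1 else i%:R * psum i.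

(* Only meaningful for [0 < j]: the first task of the last of [j + 1] groups. *)
Definition last_start (j i : nat) : nat := (scan (opt_cost j.-1) i i).2.

Fixpoint group_of (j i x : nat) : nat :=
  if j is j'.+1 then
    let k := last_start j i in if (x < k)%N then group_of j' k x else j
  else 0%N.

Definition partition_cost (g : nat -> nat) (i : nat) : R :=
  \sum_(x < i) \sum_(y < i | g y == g x) v y.

Lemma scanP f i k : (k <= i)%N ->
  let p := scan f i k in
  [/\ (p.2 <= i)%N, p.1 = f p.2 + block_cost p.2 i, p.1 <= f i
    & forall k', (k' < k)%N -> p.1 <= f k' + block_cost k' i].
Proof.
elim: k => [|k IHk] leki /=.
  by split=> //; rewrite /block_cost !subrr mul0r addr0.
have [h1 h2 h3 h4] := IHk (ltnW leki); case: leP => [le|/ltW le]; split=> //=.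
- exact: ltnW.
- exact: le_trans h3.
- move=> k'; rewrite ltnS leq_eqVlt => /orP[/eqP -> //|/h4].
  exact: le_trans.
- by move=> k'; rewrite ltnS leq_eqVlt => /orP[/eqP -> //|/h4].
Qed.

Lemma last_start_leq j i : (last_start j i <= i)%N.
Proof. by have [] := scanP (opt_cost j.-1) (leqnn i). Qed.

Lemma opt_costS j i : opt_cost j.+1 i =
  opt_cost j (last_start j.+1 i) + block_cost (last_start j.+1 i) i.
Proof. by have [] := scanP (opt_cost j) (leqnn i). Qed.

Lemma opt_cost_le j k i : (k <= i)%N ->
  opt_cost j.+1 i <= opt_cost j k + block_cost k i.
Proof.
rewrite leq_eqVlt => /orP[/eqP ->|ltki]; have [_ _ h1 h2] := scanP (opt_cost j) (leqnn i).
  by rewrite /block_cost !subrr mul0r addr0.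
exact: h2.
Qed.

Lemma group_of_leq j i x : (group_of j i x <= j)%N.
Proof. by elim: j i => //= j IHj i; case: ifP => // _; apply/leqW/IHj. Qed.

Lemma psumB k d : psum (k + d) - psum k = \sum_(y < d) v (k + y)%N.
Proof. by rewrite /psum big_split_ord /= addrAC subrr add0r. Qed.

(** The positions from [k] on form one group that no earlier position joins, so the double sum
    splits there without cross terms. *)
Lemma partition_cost_block g g' c k d :
    (forall x, (x < k)%N -> g x = g' x) -> (forall x, (x < k)%N -> g x != c) ->
    (forall x, g (k + x)%N = c) ->
  partition_cost g (k + d) = partition_cost g' k + block_cost k (k + d).
Proof.
move=> lo neq hi; rewrite /partition_cost /block_cost big_split_ord /=; congr (_ + _).
  apply: eq_bigr => x _; rewrite big_mkcond big_split_ord /= [X in _ + X]big1 => [|y _].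
    by rewrite addr0 [RHS]big_mkcond; apply: eq_bigr => y _; rewrite !lo.
  by rewrite hi eq_sym (negPf (neq _ _)).
rewrite psumB natrD addrAC subrr add0r (eq_bigr (fun=> \sum_(y < d) v (k + y)%N)).
  by rewrite sumr_const card_ord mulr_natl.
move=> x _; rewrite big_mkcond big_split_ord /= [X in X + _]big1 ?add0r => [|y _].
  by apply: eq_bigr => y _; rewrite !hi eqxx.
by rewrite hi (negPf (neq _ _)).
Qed.

(** Induction peels off the last group: its number [j.+1] exceeds every value of [group_of j], so no
    earlier task shares it. *)
Lemma partition_cost_group_of j i :
  partition_cost (group_of j i) i = opt_cost j i.
Proof.
elim: j i => [|j IHj] i.
  rewrite /partition_cost /= (eq_bigr (fun=> psum i)) => [|x _].
    by rewrite sumr_const card_ord mulr_natl.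
  by apply: eq_bigl => y; rewrite eqxx.
rewrite opt_costS -IHj.
move: (last_start_leq j.+1 i); move ek: (last_start j.+1 i) => k leki.
have := @partition_cost_block (group_of j.+1 i) (group_of j k) j.+1 k (i - k).
rewrite subnKC //; apply=> x.
- by move=> ltxk /=; rewrite ek ltxk.
- by move=> ltxk /=; rewrite ek ltxk ltn_eqF // ltnS group_of_leq.
- by rewrite /= ek ltnNge leq_addr.
Qed.

(** * Rearrangement inequality and group sizes *)

Definition dot (u : nat -> R) (c : seq nat) : R :=
  \sum_(x < size c) u x * (nth 0%N c x)%:R.

Lemma dot_cons u a c : dot u (a :: c) = u 0%N * a%:R + dot (u \o succn) c.
Proof. by rewrite /dot /= big_ord_recl. Qed.

Fixpoint insert (a : nat) (c : seq nat) : seq nat :=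
  if c is b :: c' then if (a <= b)%N then a :: c else b :: insert a c'
  else [:: a].

Lemma perm_insert a c : perm_eq (insert a c) (a :: c).
Proof.
elim: c => //= b c IHc; case: ifP => // _.
by apply/permP => p; have /permP/(_ p) /= := IHc; lia.
Qed.

Lemma insert_sorted a c : sorted leq c -> sorted leq (insert a c).
Proof.
elim: c => //= b c IHc sc; case: leqP => [leab | /ltnW leba] /=; first by rewrite leab.
have := IHc (path_sorted sc).
case: c sc {IHc} => [|d c] /=; first by rewrite leba.
by move=> /andP[lebd _]; case: ifP => _ /= ->; rewrite ?leba ?lebd.
Qed.

(** Moving [a] past a smaller [b] exchanges two neighbours and lowers the sum by
    [(u 0 - u 1) * (a - b)], which is nonnegative. *)
Lemma dot_insert u a c : {homo u : x y / (x <= y)%N >-> y <= x} ->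
  dot u (insert a c) <= dot u (a :: c).
Proof.
elim: c u => // b c IHc u anti /=; case: leqP => // ltba.
rewrite dot_cons; have anti' : {homo u \o succn : x y / (x <= y)%N >-> y <= x}.
  by move=> x y lexy; apply: anti.
rewrite (le_trans (lerD (lexx _) (IHc _ anti'))) //.
rewrite !dot_cons /= !addrA lerD2r.
have := anti 0%N 1%N isT; have: (b%:R : R) <= a%:R by rewrite ler_nat ltnW.
nra.
Qed.

(** This is insertion sort: the tail is sorted against the shifted [u], then the head is inserted,
    and neither raises the sum. *)
Lemma rearrangement u c : {homo u : x y / (x <= y)%N >-> y <= x} ->
  exists2 c', sorted leq c' & perm_eq c' c /\ dot u c' <= dot u c.
Proof.
elim: c u => [|a c IHc] u anti; first by exists [::].
have [|c' sc' [pc' le]] := IHc (u \o succn); first by move=> x y lexy; apply: anti.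
exists (insert a c'); first exact: insert_sorted.
split; first by rewrite (perm_trans (perm_insert _ _)) ?perm_cons.
by rewrite (le_trans (dot_insert _ _ anti)) // !dot_cons lerD2l.
Qed.

(* Lists, for every task, the size of its group, when [ks] lists the sizes of
   the groups. *)
Definition spread (ks : seq nat) : seq nat := flatten [seq nseq k k | k <- ks].

Lemma spread_sorted ks : sorted leq ks -> sorted leq (spread ks).
Proof.
elim: ks => //= k ks IHks sk; rewrite /spread /=.
rewrite (sorted_pairwise leq_trans) pairwise_cat -!(sorted_pairwise leq_trans).
rewrite IHks ?(path_sorted sk) // andbT; apply/andP; split.
  apply/allrelP => x y /nseqP[-> _] /flatten_mapP[l lks /nseqP[-> _]].
  by have /allP/(_ _ lks) := order_path_min leq_trans sk.
by elim: {1}k => //= -[|l] //= ->; rewrite leqnn.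
Qed.

Lemma size_spread ks : size (spread ks) = sumn ks.
Proof.
rewrite size_flatten /shape -map_comp (eq_map (g := id)) ?map_id // => k /=.
by rewrite size_nseq.
Qed.

(** The right side is the cost of consecutive intervals of lengths [ks]. Removing the last interval
    matches one step of the recurrence, where [sumn] of the other lengths is one of the candidate
    cut points. *)
Lemma opt_cost_le_spread ks :
  ks != [::] -> opt_cost (size ks).-1 (sumn ks) <= dot v (spread ks).
Proof.
elim/last_ind: ks => // ks k IHks _.
have dotE : dot v (spread (rcons ks k)) =
    dot v (spread ks) + block_cost (sumn ks) (sumn ks + k).
  rewrite /spread map_rcons flatten_rcons -!/(spread ks) /dot size_cat size_nseq.
  rewrite big_split_ord /= /block_cost psumB natrD addrAC subrr add0r mulr_sumr.
  congr (_ + _); apply: eq_bigr => x _; first by rewrite nth_cat ltn_ord.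
  by rewrite nth_cat ltnNge leq_addr /= addKn nth_nseq ltn_ord size_spread mulrC.
rewrite size_rcons /= sumn_rcons dotE; case: (eqVneq ks [::]) => [->|nks].
  by rewrite /dot big_ord0 add0r /block_cost /= /psum big_ord0 !subr0.
rewrite (le_trans _ (lerD (IHks nks) (lexx _))) //.
by case: ks nks {IHks dotE} => // l ks _; apply: opt_cost_le; apply: leq_addr.
Qed.

End Dynamic.

(** * Optimality of the interval assignment *)

Section Optimality.
Local Open Scope ring_scope.
Variables (R : realType) (m n : nat) (I : instance R m n).
Hypothesis unit : unit_delay I.

Definition weight_nat (i : nat) : R := oapp (weight I) 0 (insub i).
Local Notation w := weight_nat.
Local Notation v := (by_rank w n).

Lemma weight_natE (i : 'I_n) : w i = weight I i.
Proof. by rewrite /weight_nat valK. Qed.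

Lemma weight_nat_ge0 i : 0 <= w i.
Proof.
rewrite /weight_nat; case: insubP => //= j _ _.
exact: le_trans (weight_ge1 I j).
Qed.

Lemma sum_by_rank (P : nat -> R -> R) :
  \sum_(i < n) P (rank w n i) (weight I i) = \sum_(x < n) P x (v x).
Proof.
rewrite [RHS](reindex_inj (@rank_ord_inj R w n)) /=; apply: eq_bigr => i _.
by rewrite by_rankK // weight_natE.
Qed.

Lemma social_costE (A : assignment m n) :
  social_cost I A = \sum_(i < n) \sum_(k < n | A k == A i) weight I k.
Proof. by apply: eq_bigr => i _; rewrite /load unit mul1r. Qed.

Lemma social_cost_by_rank (A : assignment m n) (g : nat -> nat) :
    (forall i, A i = g (rank w n i) :> nat) ->
  social_cost I A = partition_cost v g n.
Proof.
move=> Ag; rewrite social_costE /partition_cost.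
rewrite [RHS](reindex_inj (@rank_ord_inj R w n)) /=; apply: eq_bigr => i _.
rewrite big_mkcond [RHS]big_mkcond /=.
rewrite -(sum_by_rank (fun x a => if g x == g (rank w n i) then a else 0)).
by apply: eq_bigr => k _; rewrite -!Ag.
Qed.

Lemma opt_cost_le_social_cost (A : assignment m n) :
  (0 < m)%N -> opt_cost v m.-1 n <= social_cost I A.
Proof.
move=> m_gt0; pose sz (l : 'I_m) := (\sum_(k < n) (A k == l))%N.
have [inv invK rankK] := injF_bij (@rank_ord_inj R w n).
(* In rank order, the size of the group to which each task belongs. *)
pose c := [seq sz (A (inv x)) | x <- enum 'I_n].
have size_c : size c = n by rewrite size_map size_enum_ord.
have -> : social_cost I A = dot v c.
  rewrite /dot size_c (reindex_inj (@rank_ord_inj R w n)) /=.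
  transitivity (\sum_(i < n) weight I i * (sz (A i))%:R).
    (* After the exchange, the weight of task [k] is counted once for each member of its group. *)
    rewrite social_costE (exchange_big_dep xpredT) //=; apply: eq_bigr => k _.
    rewrite big_mkcond /sz natr_sum mulr_sumr; apply: eq_bigr => i _.
    by rewrite eq_sym; case: eqP => _; rewrite ?mulr1 ?mulr0.
  apply: eq_bigr => i _; rewrite by_rankK // weight_natE; congr (_ * _%:R).
  rewrite (nth_map i) ?size_enum_ord ?rank_bound //.
  by rewrite -[X in nth _ _ X]/(val (rank_ord w i)) nth_ord_enum invK.
pose ks := [seq sz l | l <- enum 'I_m].
have size_ks : size ks = m by rewrite size_map size_enum_ord.
have [c' sc' [pc' /(le_trans _) -> //]] :=
  rearrangement c (by_rank_anti n weight_nat_ge0).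
have sum_ks : sumn (sort leq ks) = n.
  rewrite (perm_sumn (permEl (perm_sort _ _))) sumnE big_map big_enum /= exchange_big /=.
  rewrite (eq_bigr (fun=> 1%N)) ?sum1_card ?card_ord // => k _.
  by rewrite (bigD1 (A k)) //= eqxx big1 // => l /negPf; rewrite eq_sym => ->.
(* Both lists are sorted, so it is enough that they are permutations of each other: a group of size
   [s] contributes [s] entries equal to [s] to each. *)
suff -> : c' = spread (sort leq ks).
  have := @opt_cost_le_spread _ v (sort leq ks).
  rewrite size_sort size_ks sum_ks; apply.
  by rewrite -size_eq0 size_sort size_ks -lt0n.
apply: (sorted_eq leq_trans anti_leq) => //.
  exact/spread_sorted/(sort_sorted leq_total).
rewrite (perm_trans pc') // perm_sym (perm_trans (y := spread ks)) //.
  by apply/perm_flatten/perm_map; rewrite perm_sort.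
apply/permP => p; rewrite count_flatten -2!map_comp sumnE big_map big_enum /=.
rewrite count_map -sum1_count big_enum_cond /= [RHS]big_mkcond.
rewrite (reindex_inj (@rank_ord_inj R w n)) /=.
under eq_bigr => l _ do rewrite count_nseq {2}/sz big_distrr /=.
rewrite exchange_big; apply: eq_bigr => k _ /=; rewrite invK.
rewrite (bigD1 (A k)) //= eqxx muln1 big1 ?addn0 => [|l /negPf].
  by case: ifP.
by rewrite eq_sym => ->; rewrite muln0.
Qed.

Lemma optimal_group_of (A : assignment m n) : (0 < m)%N ->
    (forall i, A i = group_of v m.-1 n (rank w n i) :> nat) ->
  optimal I A.
Proof.
move=> m_gt0 Ag B; rewrite (social_cost_by_rank Ag) partition_cost_group_of.
exact: opt_cost_le_social_cost.
Qed.

End Optimality.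

(** * Timed execution *)

Section Runs.
Variable R : realType.
Implicit Types (s : state R) (c : cmd) (Q : state R -> Prop).

(** Total correctness with a time bound; sequences are handled by nesting [runs] in the
    postcondition. *)
Definition runs c s (T : nat) Q : Prop :=
  exists t s', [/\ exec c s t s', t <= T & Q s'].

Lemma runs_weaken c s T T' Q Q' : runs c s T Q -> T <= T' ->
  (forall s', Q s' -> Q' s') -> runs c s T' Q'.
Proof.
move=> [t [s' [ex le q]]] leT imp; exists t, s'; split=> //; last exact: imp.
exact: leq_trans leT.
Qed.

Lemma runs_seq c1 c2 s T1 T2 Q :
  runs c1 s T1 (fun s' => runs c2 s' T2 Q) -> runs (CSeq c1 c2) s (T1 + T2) Q.
Proof.
move=> [t1 [s1 [ex1 le1 [t2 [s2 [ex2 le2 q]]]]]]; exists (t1 + t2), s2.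
by split=> //; [apply: exec_seq ex1 ex2 | apply: leq_add].
Qed.

(** There are [hi - lo] passes and one failing test, which is charged as a full pass. *)
Lemma runs_while (Inv : nat -> state R -> Prop) b c T lo hi s :
    lo <= hi ->
    (forall k s', lo <= k < hi -> Inv k s' ->
      beval s' b /\ runs c s' T (Inv k.+1)) ->
    (forall s', Inv hi s' -> ~~ beval s' b) ->
  Inv lo s -> runs (CWhile b c) s ((hi - lo).+1 * (bcost b + T)) (Inv hi).
Proof.
move=> lelh body stop; move: {2}(hi - lo) (erefl (hi - lo)) => d.
elim: d lo s lelh body => [|d IHd] lo s lelh body ed inv.
  have elo : lo = hi by lia.
  rewrite ed elo in inv *; exists (bcost b), s; split=> //; last by lia.
  exact/exec_while_false/stop.
have [|bs [t1 [s1 [ex1 le1 inv1]]]] := body lo s _ inv; first by lia.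
have [||||t2 [s2 [ex2 le2 inv2]]] := IHd lo.+1 s1 => //; [lia| |lia|].
  by move=> k s' kin; apply: body; lia.
exists (bcost b + t1 + t2), s2; split=> //; first exact: exec_while_true ex2.
have -> : (hi - lo).+1 = (hi - lo.+1).+2 by lia.
rewrite mulSn; lia.
Qed.

Fixpoint straight c : bool :=
  match c with
  | CSeq c1 c2 | CIf _ c1 c2 => straight c1 && straight c2
  | CWhile _ _ => false
  | _ => true
  end.

(** Both branches of a test are charged, so that the bound does not depend on the state. *)
Fixpoint straight_cost c : nat :=
  match c with
  | CISet _ e f => (icost e + icost f).+1
  | CRSet _ e f => (icost e + rcost f).+1
  | CSeq c1 c2 => straight_cost c1 + straight_cost c2
  | CIf b c1 c2 => bcost b + (straight_cost c1 + straight_cost c2)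
  | _ => 0
  end.

Fixpoint step c s : state R :=
  match c with
  | CISet a e f => State (upd (ints s) a (ieval s e) (ieval s f)) (reals s)
  | CRSet a e f => State (ints s) (upd (reals s) a (ieval s e) (reval s f))
  | CSeq c1 c2 => step c2 (step c1 s)
  | CIf b c1 c2 => if beval s b then step c1 s else step c2 s
  | _ => s
  end.

Lemma exec_straight c s : straight c ->
  exists2 t, t <= straight_cost c & exec c s t (step c s).
Proof.
elim: c s => //= [|a e f|a e f|c1 IH1 c2 IH2|b c1 IH1 c2 IH2] s.
- by exists 0; last exact: exec_skip.
- by eexists; last exact: exec_iset.
- by eexists; last exact: exec_rset.
- move=> /andP[/(IH1 s)[t1 le1 ex1] /(IH2 (step c1 s))[t2 le2 ex2]].
  by exists (t1 + t2); [apply: leq_add | apply: exec_seq ex1 ex2].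
- move=> /andP[/(IH1 s)[t1 le1 ex1] /(IH2 s)[t2 le2 ex2]].
  case bs: (beval s b).
    exists (bcost b + t1); last by apply: exec_if; rewrite bs.
    by rewrite leq_add2l (leq_trans le1) ?leq_addr.
  exists (bcost b + t2); last by apply: exec_if; rewrite bs.
  by rewrite leq_add2l (leq_trans le2) ?leq_addl.
Qed.

Lemma runs_straight T c s Q : straight c -> straight_cost c <= T ->
  Q (step c s) -> runs c s T Q.
Proof.
move=> /(exec_straight s)[t le ex] leT q; exists t, (step c s).
by split=> //; apply: leq_trans leT.
Qed.

End Runs.

(** * The text of the program *)

Local Notation "c ;; d" := (CSeq c d) (at level 60, right associativity).
Local Notation var x := (IGet x (ICst 0)).
Local Notation "x <-- e" := (CISet x (ICst 0) e) (at level 55).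
Local Notation lt e f := (BNot (BILe f e)).

(* Natural arrays: 1 answer, 2 ranks, 3 cut points of the dynamic program.
   Arrays 4-10 hold scalars in cell 0: task or prefix length (4), row (5), inner
   index (6), rank or cut point (7), start of the previous (8) and of the current
   (9) table row, length of the prefix still to be cut (10).  Real arrays:
   0 weights, 2 sorted weights, 3 prefix sums, 4 the numerals (there is no
   conversion from naturals to reals), 5 costs of the dynamic program; 6 and 7
   hold the best and the candidate cost in cell 0.  Entry [(j, i)] of the tables
   3 and 5 is cell [j * n.+1 + i]. *)
Definition n_ := IGet 0 (ICst 0).
Definition m_ := IGet 0 (ICst 1).
Definition one := ICst 1.
Definition incr x := CISet x (ICst 0) (IAdd (IGet x (ICst 0)) (ICst 1)).

(** Tests have no disjunction, so [before] is encoded by De Morgan. *)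
Definition count_before :=
  CWhile (lt (var 6) n_)
   (CIf (BNot (BAnd (BRLe (RGet 0 (var 6)) (RGet 0 (var 4)))
                    (BNot (BAnd (BRLe (RGet 0 (var 4)) (RGet 0 (var 6)))
                                (lt (var 6) (var 4))))))
      (incr 7) CSkip ;;
    incr 6).

(** Every answer is initialised to 0, the number of the first group, so backtracking need not write
    that group. *)
Definition compute_ranks :=
  4 <-- ICst 0 ;;
  CWhile (lt (var 4) n_)
   ((6 <-- ICst 0 ;; 7 <-- ICst 0) ;;
    count_before ;;
    (CISet 2 (var 4) (var 7) ;;
     CRSet 2 (var 7) (RGet 0 (var 4)) ;;
     CISet 1 (var 4) (ICst 0) ;;
     incr 4)).

Definition compute_sums :=
  (4 <-- ICst 0 ;;
   CRSet 3 (ICst 0) RZero ;; CRSet 4 (ICst 0) RZero ;; CRSet 5 (ICst 0) RZero) ;;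
  CWhile (lt (var 4) n_)
   (CRSet 3 (IAdd (var 4) one) (RAdd (RGet 3 (var 4)) (RGet 2 (var 4))) ;;
    CRSet 4 (IAdd (var 4) one) (RAdd (RGet 4 (var 4)) ROne) ;;
    incr 4 ;;
    CRSet 5 (var 4) (RMul (RGet 4 (var 4)) (RGet 3 (var 4)))).

Definition best_cut :=
  CWhile (lt (var 6) (var 4))
   (CRSet 7 (ICst 0)
      (RAdd (RGet 5 (IAdd (var 8) (var 6)))
            (RMul (RSub (RGet 4 (var 4)) (RGet 4 (var 6)))
                  (RSub (RGet 3 (var 4)) (RGet 3 (var 6))))) ;;
    CIf (BRLe (RGet 7 (ICst 0)) (RGet 6 (ICst 0)))
      (CRSet 6 (ICst 0) (RGet 7 (ICst 0)) ;; 7 <-- var 6) CSkip ;;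
    incr 6).

Definition fill_row :=
  CWhile (BILe (var 4) n_)
   ((CRSet 6 (ICst 0) (RGet 5 (IAdd (var 8) (var 4))) ;;
     7 <-- var 4 ;; 6 <-- ICst 0) ;;
    best_cut ;;
    (CRSet 5 (IAdd (var 9) (var 4)) (RGet 6 (ICst 0)) ;;
     CISet 3 (IAdd (var 9) (var 4)) (var 7) ;;
     incr 4)).

(** Row 0 comes from [compute_sums]. Row starts advance by adding [n + 1], since indices cannot be
    multiplied. *)
Definition fill_table :=
  (5 <-- one ;; 8 <-- ICst 0 ;; 9 <-- IAdd n_ one) ;;
  CWhile (lt (var 5) m_)
   (4 <-- ICst 0 ;;
    fill_row ;;
    (8 <-- var 9 ;; 9 <-- IAdd (var 9) (IAdd n_ one) ;; incr 5)).

Definition assign_group :=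
  CWhile (lt (var 4) n_)
   (CIf (BAnd (BILe (var 7) (IGet 2 (var 4))) (lt (IGet 2 (var 4)) (var 10)))
      (CISet 1 (var 4) (var 5)) CSkip ;;
    incr 4).

Definition backtrack :=
  10 <-- n_ ;;
  CWhile (lt one (var 5))
   ((5 <-- ISub (var 5) one ;;
     7 <-- IGet 3 (IAdd (var 8) (var 10)) ;; 4 <-- ICst 0) ;;
    assign_group ;;
    (10 <-- var 7 ;; 8 <-- ISub (var 8) (IAdd n_ one))).

Definition solver := compute_ranks ;; compute_sums ;; fill_table ;; backtrack.

(** * Correctness and cost of the program *)

Section Verification.
Variables (R : realType) (w : nat -> R) (n m : nat).
Implicit Type s : state R.
Local Notation v := (by_rank w n).
Local Notation rank := (rank w n).

(** * Ranking and prefix sums *)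

Definition sized s : Prop := ints s 0 0 = n /\ ints s 0 1 = m.

Definition ranked i s : Prop := forall x, x < i ->
  [/\ ints s 2 x = rank x, reals s 2 (rank x) = w x & ints s 1 x = 0].

Definition rank_inv i s : Prop :=
  [/\ sized s, forall x, x < n -> reals s 0 x = w x, ranked i s & ints s 4 0 = i].

Definition count_inv i k s : Prop :=
  [/\ rank_inv i s, ints s 6 0 = k & ints s 7 0 = \sum_(x < k) before w x i].

Lemma count_beforeP i s : i < n -> count_inv i 0 s ->
  runs count_before s (n.+1 * 100) (count_inv i n).
Proof.
move=> ltin inv.
(* The constant is a rounded bound on one pass; together with the test it stays below 100. The later
   loops are bounded likewise. *)
apply: (runs_weaken (runs_while (T := 60) (Inv := count_inv i) (leq0n n) _ _ inv)) => //.
- move=> k s' /= ltkn [[[en em] ew rk e4] e6 e7]; split.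
    by rewrite /= e6 en -ltnNge.
  apply: runs_straight => //=.
  rewrite e4 e6 !ew // negb_and negbK -ltnNge -/(before w k i).
  by case eb: before; split=> //=;
    rewrite /upd /= ?e6 ?e7 ?addn1 // big_ord_recr /= eb ?addn0 ?addn1.
- by move=> s' [[[en _] _ _ _] e6 _]; rewrite /= e6 en leqnn.
- by rewrite subn0 leq_mul2l.
Qed.

Lemma compute_ranksP s : sized s -> (forall x, x < n -> reals s 0 x = w x) ->
  runs compute_ranks s (50 + n.+1 * (n.+1 * 100 + 200)) (rank_inv n).
Proof.
move=> [en em] ew; apply/runs_seq/runs_straight => //=.
apply: (runs_weaken (runs_while (T := 50 + (n.+1 * 100 + 50))
  (Inv := rank_inv) (leq0n n) _ _ _)) => //.
- move=> i s' /= ltin [[en' em'] ew' rk e4]; split.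
    by rewrite /= e4 en' -ltnNge.
  apply/runs_seq/runs_straight => //=; apply: runs_seq.
  apply: runs_weaken (count_beforeP ltin _) (leqnn _) _.
    by split=> //=; rewrite big_ord0.
  move=> s2 [[[en2 em2] ew2 rk2 e42] e6 e7]; apply: runs_straight => //=.
  rewrite /upd /= e42 e7 -/(rank i) ew2 //; split=> //=; last by rewrite addn1.
  move=> x /=; rewrite ltnS leq_eqVlt => /orP[/eqP ->|ltxi]; first by rewrite !eqxx.
  have [r1 r2 r3] := rk2 x ltxi; rewrite (ltn_eqF ltxi); split=> //.
  (* Distinct tasks have distinct ranks, so the new sorted weight overwrites no earlier one. *)
  case: eqP => // /rank_inj -> //; exact: ltn_trans ltin.
- by move=> s' [[en' _] _ _ e4]; rewrite /= e4 en' leqnn.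
- by rewrite subn0 leq_mul2l /=; lia.
Qed.

Definition sorted_input s : Prop :=
  sized s /\ forall x, x < n -> ints s 2 x = rank x /\ ints s 1 x = 0.

Definition sums_inv i s : Prop :=
  [/\ sorted_input s, forall x, x < n -> reals s 2 x = v x, ints s 4 0 = i
    & forall x, x <= i -> [/\ reals s 3 x = psum v x, reals s 4 x = x%:R%R
                            & reals s 5 x = opt_cost v 0 x]].

Lemma compute_sumsP s : rank_inv n s ->
  runs compute_sums s (50 + n.+1 * 100) (sums_inv n).
Proof.
move=> [[en em] _ rk _]; apply/runs_seq/runs_straight => //=.
apply: (runs_weaken (runs_while (T := 60) (Inv := sums_inv) (leq0n n) _ _ _)) => //.
- move=> i s' /= ltin [[[en' em'] rk'] ev e4 pre]; split.
    by rewrite /= e4 en' -ltnNge.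
  have [p3 p4 p5] := pre i (leqnn i).
  apply: runs_straight => //=; rewrite /upd /= e4 addn1 eqxx p3 p4 ev //.
  split=> //= x; rewrite leq_eqVlt => /orP[/eqP ->|ltxi].
    have -> : psum v i.+1 = (psum v i + v i)%R by rewrite /psum big_ord_recr.
    by rewrite !eqxx natr1.
  by rewrite (ltn_eqF ltxi); apply: pre.
- by move=> s' [[[en' _] _] _ e4 _]; rewrite /= e4 en' leqnn.
- split=> //=.
  + by split=> // x ltxn; have [] := rk x ltxn.
  + move=> x ltxn; have [inv _ invK] := injF_bij (@rank_ord_inj R w n).
    have ex : x = rank (inv (Ordinal ltxn)) by rewrite -[RHS]/(val (rank_ord w _)) invK.
    by rewrite ex by_rankK //; have [] := rk _ (ltn_ord (inv (Ordinal ltxn))).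
  + by move=> x; rewrite leqn0 => /eqP ->; rewrite /upd /= /psum big_ord0 mulr0.
- by rewrite subn0 leq_mul2l.
Qed.

(** * Filling the table *)

Definition table X s : Prop := forall x, x < X ->
  reals s 5 x = opt_cost v (x %/ n.+1) (x %% n.+1) /\
  (n < x -> ints s 3 x = last_start v (x %/ n.+1) (x %% n.+1)).

Definition table_inv j X s : Prop :=
  [/\ sorted_input s,
      forall x, x <= n -> reals s 3 x = psum v x /\ reals s 4 x = x%:R%R,
      table X s
    & [/\ ints s 5 0 = j.+1, ints s 8 0 = j * n.+1 & ints s 9 0 = j.+1 * n.+1]].

(** The table is filled in row-major order, so one linear bound covers the complete rows and the
    first [i] cells of row [j.+1]. *)
Definition row_inv j i s : Prop :=
  table_inv j (j.+1 * n.+1 + i) s /\ ints s 4 0 = i.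

Definition cut_inv j i k s : Prop :=
  [/\ row_inv j i s, ints s 6 0 = k,
      reals s 6 0 = (scan v (opt_cost v j) i k).1
    & ints s 7 0 = (scan v (opt_cost v j) i k).2].

Lemma cell_divn j i : i <= n -> (j * n.+1 + i) %/ n.+1 = j.
Proof. by move=> lein; rewrite divnMDl // divn_small // addn0. Qed.

Lemma cell_modn j i : i <= n -> (j * n.+1 + i) %% n.+1 = i.
Proof. by move=> lein; rewrite modnMDl modn_small. Qed.

Lemma table_cost X s j i : table X s -> i <= n -> j * n.+1 + i < X ->
  reals s 5 (j * n.+1 + i) = opt_cost v j i.
Proof. by move=> tab lein /tab[-> _]; rewrite cell_divn ?cell_modn. Qed.

Lemma best_cutP j i s : i <= n -> cut_inv j i 0 s ->
  runs best_cut s (n.+1 * 100) (cut_inv j i i).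
Proof.
move=> lein inv.
apply: (runs_weaken (runs_while (T := 80) (Inv := cut_inv j i) (leq0n i) _ _ inv)) => //.
- move=> k s' /= ltki [[[si pre tab [e5 e8 e9]] e4] e6 er e7]; split.
    by rewrite /= e6 e4 -ltnNge.
  apply: runs_straight => //=.
  rewrite /upd /= e4 e6 e8 er (table_cost tab) ?(leq_trans (ltnW ltki)) //; last by nia.
  have [-> ->] := pre i lein; have [-> ->] := pre k (leq_trans (ltnW ltki) lein).
  rewrite -/(block_cost v k i).
  case: ifP => le /=; split=> //=; rewrite /upd /= ?e6 ?addn1 ?le //.
- by move=> s' [[[_ _ _ _] e4] e6 _ _]; rewrite /= e6 e4 leqnn.
- by rewrite subn0 leq_mul.
Qed.

Lemma fill_rowP j s : row_inv j 0 s ->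
  runs fill_row s (n.+2 * (n.+1 * 100 + 200)) (row_inv j n.+1).
Proof.
move=> inv.
apply: (runs_weaken (runs_while (T := 50 + (n.+1 * 100 + 50))
  (Inv := row_inv j) (leq0n n.+1) _ _ inv)) => //.
- move=> i s' /= lein [[si pre tab [e5 e8 e9]] e4]; rewrite ltnS in lein; split.
    by rewrite /= e4 si.1.1.
  apply/runs_seq/runs_straight => //=; apply: runs_seq.
  apply: runs_weaken (best_cutP (j := j) lein _) (leqnn _) _.
    by split=> //=; rewrite /upd /= e4 e8 (table_cost tab) //; nia.
  move=> s2 [[[si2 pre2 tab2 [e52 e82 e92]] e42] _ er e7].
  apply: runs_straight => //=; rewrite /upd /= e42 e92 er e7.
  split=> //=; last by rewrite addn1.
  split=> //= x; rewrite addnS ltnS leq_eqVlt => /orP[/eqP ->|ltx].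
    by rewrite /= eqxx cell_divn // cell_modn.
  by rewrite /= (ltn_eqF ltx); apply: tab2.
- by move=> s' [[si _ _ _] e4]; rewrite /= e4 si.1.1 -ltnNge.
- by rewrite subn0 leq_mul2l /=; lia.
Qed.

Lemma fill_tableP s : 0 < m -> sums_inv n s ->
  runs fill_table s (50 + m * (n.+2 * (n.+1 * 100 + 200) + 200))
    (table_inv m.-1 (m * n.+1)).
Proof.
move=> m_gt0 [si ev _ pre]; apply/runs_seq/runs_straight => //=.
have -> : m * n.+1 = m.-1.+1 * n.+1 by rewrite prednK.
(* Here [j] is the last finished row; since row 0 is already there, [m.-1] passes remain. *)
apply: (runs_weaken (runs_while (T := 50 + (n.+2 * (n.+1 * 100 + 200) + 50))
  (Inv := fun j => table_inv j (j.+1 * n.+1)) (leq0n m.-1) _ _ _)) => //.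
- move=> j s' /= ltjm [si' pre' tab [e5 e8 e9]]; split.
    by rewrite /= e5 si'.1.2 -ltnNge; lia.
  apply/runs_seq/runs_straight => //=; apply: runs_seq.
  apply: runs_weaken (fill_rowP (j := j) _) (leqnn _) _.
    by split=> //=; split=> //=; rewrite addn0.
  move=> s2 [[si2 pre2 tab2 [e52 e82 e92]] e42].
  apply: runs_straight => //=; split=> //=.
    by move=> x ltx; apply: tab2; lia.
  by rewrite /upd /= e52 e92 si2.1.1; split; lia.
- by move=> s' [si' _ _ [e5 _ _]]; rewrite /= e5 si'.1.2 prednK // leqnn.
- split=> //=.
  + by move=> x lexn; have [] := pre x lexn.
  (* The cells up to [n] are row 0, which has no cut points to check. *)
  + move=> x; rewrite mul1n ltnS => lexn; have [_ _] := pre x lexn.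
    by rewrite divn_small // modn_small //; split=> //; rewrite ltnNge lexn.
  + by rewrite /upd /= si.1.1 mul0n; split; lia.
- by rewrite subn0 prednK // leq_mul2l /=; lia.
Qed.

(** * Recovering the groups *)

Definition backtrack_inv j s : Prop :=
  exists h, [/\ sized s, forall x, x < n -> ints s 2 x = rank x,
    table (m * n.+1) s,
    [/\ ints s 5 0 = j.+1, ints s 8 0 = j * n.+1, ints s 10 0 = h & h <= n]
  & [/\ j < m, forall x, x < h -> group_of v m.-1 n x = group_of v j h x
     & forall x, x < n -> ints s 1 x =
         if rank x < h then 0 else group_of v m.-1 n (rank x)]].

(** Tasks below [i] have been compared with the new cut point; for the others the threshold is still
    [h]. *)
Definition assign_inv j h i s : Prop :=
  [/\ sized s, forall x, x < n -> ints s 2 x = rank x,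
      table (m * n.+1) s,
      [/\ ints s 5 0 = j.+1, ints s 8 0 = j.+1 * n.+1, ints s 10 0 = h,
          ints s 7 0 = last_start v j.+1 h & ints s 4 0 = i]
    & forall x, x < n -> ints s 1 x =
        if rank x < (if x < i then last_start v j.+1 h else h) then 0
        else group_of v m.-1 n (rank x)].

Lemma assign_groupP j h s :
    (forall x, x < h -> group_of v m.-1 n x = group_of v j.+1 h x) ->
    assign_inv j h 0 s ->
  runs assign_group s (n.+1 * 100) (assign_inv j h n).
Proof.
move=> eg inv.
apply: (runs_weaken (runs_while (T := 80) (Inv := assign_inv j h)
  (leq0n n) _ _ inv)) => //.
- move=> i s' /= ltin [[en em] rk tab [e5 e8 e10 e7 e4] out]; split.
    by rewrite /= e4 en -ltnNge.
  apply: runs_straight => //=; rewrite e4 e7 e10 rk // e5 -ltnNge.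
  case: ifP => [/andP[lo hi]|nin] /=; split=> //=; rewrite /upd /= ?e4 ?addn1 //.
    move=> x ltxn; case: eqP => [->|nxi] /=.
      by rewrite leqnn ltnNge lo /= eg //= ltnNge lo.
    by rewrite out // ltnS (leq_eqVlt x) (introF eqP nxi).
  (* A rank outside the interval is below the cut point or at least [h], so lowering the threshold
     does not change its case. *)
  move=> x ltxn; rewrite out // ltnS (leq_eqVlt x); case: eqP => //= ->.
  rewrite ltnn; move: nin; have := last_start_leq v j.+1 h.
  move: (last_start _ _ _) => k lekh.
  case: ltnP => [_|leh]; first by rewrite andbT ltnNge => ->.
  by rewrite ltnNge (leq_trans lekh leh).
- by move=> s' [[en _] _ _ [_ _ _ _ e4] _]; rewrite /= e4 en leqnn.
- by rewrite subn0 leq_mul2l.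
Qed.

Lemma backtrackP s : 0 < m -> table_inv m.-1 (m * n.+1) s ->
  runs backtrack s (50 + m * (n.+1 * 100 + 200))
    (fun s' => forall x, x < n -> ints s' 1 x = group_of v m.-1 n (rank x)).
Proof.
move=> m_gt0 [[[en em] rk] _ tab [e5 e8 e9]]; apply/runs_seq/runs_straight => //=.
(* The loop rule counts upwards and the group number goes down, hence [m.-1 - u]. *)
apply: (runs_weaken (runs_while (T := 50 + (n.+1 * 100 + 50))
  (Inv := fun u => backtrack_inv (m.-1 - u)) (leq0n m.-1) _ _ _)) => //.
- move=> u s' /= ltum [h [[en' em'] rk' tab' [f5 f8 f10 lehn] [ltjm eg out]]].
  have [j ej] : exists j, m.-1 - u = j.+1 by exists (m.-1 - u).-1; lia.
  have -> : m.-1 - u.+1 = j by lia.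
  rewrite ej in f5 f8 ltjm eg; split; first by rewrite /= f5.
  apply/runs_seq/runs_straight => //=; apply: runs_seq.
  (* The cell read lies inside the table and beyond row 0, so it holds a genuine cut point. *)
  have lt_idx : j.+1 * n.+1 + h < m * n.+1 by nia.
  apply: runs_weaken (assign_groupP eg _) (leqnn _) _.
    split=> //=; rewrite /upd /= f5 f8 f10 subn1; split=> //.
    by have [_ ->] := tab' _ lt_idx; [rewrite cell_divn ?cell_modn | nia].
  move=> s2 [[en2 em2] rk2 tab2 [g5 g8 g10 g7 g4] out2].
  apply: runs_straight => //=; exists (last_start v j.+1 h).
  have lekh := last_start_leq v j.+1 h.
  split=> //=; rewrite /upd /= ?g5 ?g7 ?g8 ?en2.
    by split=> //; [lia | exact: leq_trans lehn].
  split; [lia| |] => x ltx; last by rewrite out2 // ltx.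
  by rewrite eg /= ?ltx // (leq_trans ltx).
- by move=> s' [h [_ _ _ [f5 _ _ _] _]]; rewrite /= f5 subnn.
- rewrite subn0; exists n; split=> //=.
    by move=> x /rk[].
  split; [lia| by [] |] => x ltxn; rewrite rank_bound //.
  by have [] := rk x ltxn.
- by rewrite subn0 prednK // leq_mul2l /=; lia.
(* At the end the remaining prefix is group 0, which agrees with the initial answers. *)
- move=> s' [h [_ rk' _ _ [_ eg out]]] x ltxn.
  by rewrite out //; case: ifP => // /eg ->; rewrite subnn.
Qed.

Lemma solverP s : 0 < m -> sized s -> (forall x, x < n -> reals s 0 x = w x) ->
  runs solver s
    ((50 + n.+1 * (n.+1 * 100 + 200)) + ((50 + n.+1 * 100) +
     ((50 + m * (n.+2 * (n.+1 * 100 + 200) + 200)) +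
      (50 + m * (n.+1 * 100 + 200)))))
    (fun s' => forall x, x < n -> ints s' 1 x = group_of v m.-1 n (rank x)).
Proof.
move=> m_gt0 sz ew; apply: runs_seq.
apply: runs_weaken (compute_ranksP sz ew) (leqnn _) _ => s1 inv1; apply: runs_seq.
apply: runs_weaken (compute_sumsP inv1) (leqnn _) _ => s2 inv2; apply: runs_seq.
apply: runs_weaken (fill_tableP m_gt0 inv2) (leqnn _) _ => s3 inv3.
exact: backtrackP.
Qed.

End Verification.

Theorem theorem5p2 (R : realType) :
  exists (p : cmd) (c : nat),
    forall (m n : nat) (I : instance R m n),
      (0 < m)%N -> unit_delay I ->
      exists (t : nat) (s : state R) (A : assignment m n),
        [/\ exec p (input I) t s,
            outputs s A,
            optimal I A
          & (0 < n)%N -> (t <= c * (n ^ 2 * m))%N].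
Proof.
(* With [n + 1 <= 2 n] and [n + 2 <= 3 n], the four phase bounds add up to at most [3000 n^2 m], so
   5000 is generous. *)
exists solver, 5000 => m n I m_gt0 unit.
have [//|//|t [s [ex le out]]] :=
  @solverP R (weight_nat I) n m (input I) m_gt0.
pose g i := group_of (by_rank (weight_nat I) n) m.-1 n (rank (weight_nat I) n i).
have ltg i : g i < m by rewrite -[ltnRHS](prednK m_gt0) ltnS group_of_leq.
exists t, s, [ffun i : 'I_n => Ordinal (ltg i)]; split=> //.
- by move=> i; rewrite ffunE out.
- by apply: optimal_group_of => // i; rewrite ffunE.
move=> n_gt0; apply: leq_trans le _.
case: n n_gt0 {I unit ex out g ltg} => // n _; case: m m_gt0 => // m _.
rewrite expnS expn1; nia.
Qed.
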